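(* For any integers $r,t,n$ such that $2\le r\le t\le 2r\le n-2$, there exists a connected graph $G$ of order $n$ such that $dim(G)=r$ and $edim(G)=t$.
   Context: All graphs are finite and simple; the order of a graph is its number of vertices. For a connected graph $G=(V,E)$, $d_G(x,y)$ is the length of a shortest path between vertices $x,y$. A vertex $v$ distinguishes two vertices $x,y$ if $d_G(v,x)\neq d_G(v,y)$. A set $S\subseteq V$ is a metric generator for $G$ if any two distinct vertices of $G$ are distinguished by some element of $S$; the metric dimension $dim(G)$ is the minimum cardinality of a metric generator. The distance between a vertex $v$ and an edge $e=uw$ is $d_G(e,v)=\min\{d_G(u,v),d_G(w,v)\}$. A vertex $w$ distinguishes two edges $e_1,e_2$ if $d_G(w,e_1)\ne d_G(w,e_2)$. A set $S\subseteq V$ is an edge metric generator for $G$ if every two distinct edges of $G$ are distinguished by some vertex of $S$; the edge metric dimension $edim(G)$ is the smallest cardinality of an edge metric generator for $G$. *)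

(* Defs.v *)
(* MathComp *)
From mathcomp Require Import all_boot.

Set Implicit Arguments.
Unset Strict Implicit.
Unset Printing Implicit Defensive.

Record sgraph := SGraph {
  vertex :> finType;
  adj : rel vertex;
  adj_sym : symmetric adj;
  adj_irrefl : irreflexive adj }.

Section MetricDimension.
Variable G : sgraph.
Implicit Types (x y v u w : G) (e : {set G}) (S : {set G}).

Definition connected := forall x y, connect (@adj G) x y.

(* The sequence x :: p is a path (without repeated vertices) from x to y;
   its length is size p. *)
Definition graph_path x y (p : seq G) :=
  [&& path (@adj G) x p, last x p == y & uniq (x :: p)].

(* Every path has length less than #|G|, so k ranges over all path lengths; the
   default value #|G| is taken only if there is no path from x to y. *)
Definition dist x y : nat :=
  \big[minn/#|G|]_(k < #|G| | [exists p : k.-tuple G, graph_path x y p]) k.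

Definition distinguishes v x y := dist v x != dist v y.

Definition metric_generator S :=
  [forall x, forall y, (x != y) ==> [exists v in S, distinguishes v x y]].

(* The minimum is over a nonempty family of sets of size at most #|G|
   (see metric_generatorT), so the default value #|G| plays no role. *)
Definition dim : nat := \big[minn/#|G|]_(S | metric_generator S) #|S|.

(* The edge uw is the set [set u; w]. *)
Definition edges : {set {set G}} :=
  [set e : {set G} | [exists u, exists w, adj u w && (e == [set u; w])]].

(* For e = [set u; w] this is minn (dist u v) (dist w v), see edge_dist2. *)
Definition edge_dist e v : nat := \big[minn/#|G|]_(u in e) dist u v.

Definition edge_distinguishes w e1 e2 := edge_dist e1 w != edge_dist e2 w.

Definition edge_metric_generator S :=
  [forall e1 in edges, forall e2 in edges,
    (e1 != e2) ==> [exists w in S, edge_distinguishes w e1 e2]].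

(* See edge_metric_generatorT for the irrelevance of the default value. *)
Definition edim : nat := \big[minn/#|G|]_(S | edge_metric_generator S) #|S|.

Lemma bigmin_le (I : finType) (P : pred I) (F : I -> nat) n i :
  P i -> \big[minn/n]_(j | P j) F j <= F i.
Proof.
move=> Pi; have: i \in index_enum I by rewrite mem_index_enum.
elim: (index_enum I) => // j s IHs; rewrite inE big_cons.
case/predU1P=> [<-|/IHs le_s]; first by rewrite Pi geq_minl.
by case: (P j) => //; rewrite geq_min le_s orbT.
Qed.

Lemma bigmin_le_idx (I : finType) (P : pred I) (F : I -> nat) n :
  \big[minn/n]_(j | P j) F j <= n.
Proof.
by elim/big_rec: _ => // i m _ le_mn; apply: leq_trans (geq_minr _ _) le_mn.
Qed.

Lemma dist_le_card x y : dist x y <= #|G|.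
Proof. exact: bigmin_le_idx. Qed.

Lemma dist_le x y p : graph_path x y p -> dist x y <= size p.
Proof.
move=> xpy; have lt_p : size p < #|G|.
  by case/and3P: (xpy) => _ _ /card_uniqP/= <-; apply: max_card.
pose P (k : 'I_#|G|) := [exists q : k.-tuple G, graph_path x y q].
have P_p : P (Ordinal lt_p) by apply/existsP; exists (in_tuple p).
exact: (bigmin_le (fun k : 'I_#|G| => k : nat) #|G| P_p).
Qed.

Lemma dist_attained x y : connect (@adj G) x y ->
  exists2 p, graph_path x y p & size p = dist x y.
Proof.
case/connectP=> p0 /shortenP[p xp uniq_p _] y_p.
have xpy : graph_path x y p by rewrite /graph_path xp uniq_p y_p eqxx.
have lt_d : dist x y < #|G|.
  apply: leq_ltn_trans (dist_le xpy) _.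
  by case/and3P: xpy => _ _ /card_uniqP/= <-; apply: max_card.
suff: dist x y = #|G| \/ exists2 p, graph_path x y p & size p = dist x y.
  by case=> // eq_d; rewrite eq_d ltnn in lt_d.
rewrite /dist; elim/big_ind: _ => [|a b Ha Hb|k /existsP[q xqy]].
- by left.
- by rewrite /minn; case: ifP.
- by right; exists q => //; rewrite size_tuple.
Qed.

Lemma dist_eq0 x y : (dist x y == 0) = (x == y).
Proof.
apply/idP/eqP=> [/eqP d0 | <-]; last first.
  by rewrite -leqn0 (@dist_le x x [::]) //= /graph_path /= eqxx.
suff: dist x y != 0 \/ x = y by case; rewrite ?d0.
have G_gt0 : 0 < #|G| by apply/card_gt0P; exists x.
rewrite /dist; elim/big_ind: _ => [|a b [Ha|->]|k /existsP[q xqy]].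
- by left; rewrite -lt0n.
- by case=> [Hb|->]; [left; rewrite /minn; case: ifP | right].
- by right.
- case: (posnP k) => [k0|]; last by rewrite lt0n; left.
  right; case/and3P: xqy => _ /eqP <- _.
  by have /size0nil -> : size q = 0 by rewrite size_tuple.
Qed.

Lemma metric_generatorT : metric_generator setT.
Proof.
apply/forallP=> x; apply/forallP=> y; apply/implyP=> neq_xy.
apply/existsP; exists x; rewrite inE /= /distinguishes.
have /eqP -> : dist x x == 0 by rewrite dist_eq0.
by rewrite eq_sym dist_eq0.
Qed.

Lemma edge_dist2 u w v :
  edge_dist [set u; w] v = minn (dist u v) (dist w v).
Proof.
rewrite /edge_dist; apply/eqP; rewrite eqn_leq; apply/andP; split.
  by rewrite leq_min !bigmin_le // !inE eqxx ?orbT.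
elim/big_rec: _ => [|z m z_e le_m].
  by rewrite geq_min dist_le_card.
rewrite leq_min le_m andbT geq_min.
by case/set2P: z_e => ->; rewrite leqnn ?orbT.
Qed.

Lemma edge_dist_eq0 e v : e \in edges -> (edge_dist e v == 0) = (v \in e).
Proof.
rewrite inE => /existsP[u /existsP[w /andP[_ /eqP ->]]].
rewrite edge_dist2 -leqn0 geq_min !leqn0 !dist_eq0 !inE.
by rewrite ![v == _]eq_sym.
Qed.

Lemma edge_metric_generatorT : edge_metric_generator setT.
Proof.
apply/forall_inP=> e1 E1; apply/forall_inP=> e2 E2; apply/implyP.
apply: contraNT => /existsPn same; apply/eqP/setP=> v.
have := same v; rewrite inE /= /edge_distinguishes negbK => /eqP eq_d.
by rewrite -!edge_dist_eq0 // eq_d.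
Qed.

End MetricDimension.

(* Main.v *)
Require Import Defs.
From mathcomp Require Import all_boot.
From mathcomp Require Import zify.

(** The graph is a friendship graph whose triangles may degenerate to pendant
    edges, with a path attached.  A hub [t] is joined to [t] spokes
    [0, ..., t-1]; spokes [j] and [j + r] are adjacent whenever both exist, which
    gives [t - r] triangles and [2r - t] pendant edges at the hub; a tail
    [t+1, ..., n-1] hangs from the hub, and is nonempty because [t <= n - 2].

    Metric dimension [r].  The two outer vertices of a triangle are twins, so a
    generator meets each triangle; the neighbours of the hub on two branches, each
    a pendant edge or the tail, are told apart only from inside one of the two, so
    a generator misses at most one of these branches.  There are [r + 1] triangles
    and other branches in all, whence at least [r] vertices ([windmill_dim_ge]).  Conversely the spokes
    [0, ..., r-1], one per triangle or pendant edge, form a generator: the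
    remaining vertices are recognised by being at distance 1 from exactly one of
    them, or at the same distance from all of them, one more than their distance
    to the hub ([core_spokes_resolve]).  This is where [r >= 2] matters.

    Edge metric dimension [t].  The edges from the hub to its [t + 1]
    neighbours are all as close as the hub to any vertex outside their own
    branch (now counting the two ends of a triangle as different branches), so
    an edge generator misses at most one of the [t + 1] branches
    ([windmill_edim_ge]).  Conversely the [t] spokes suffice: an edge containing
    a spoke is determined by the spokes it contains, and an edge of the tail by
    its distance to any spoke ([spokes_resolve_edges]).

    All distances are read off from a closed formula, which is shown to be the
    graph distance by [dist_of_distance]. *)

Set Implicit Arguments.
Unset Strict Implicit.
Unset Printing Implicit Defensive.

(** * Minima and counting *)

Lemma bigmin_eq (I : finType) (P : pred I) (F : I -> nat) n k :
  k <= n -> (forall i, P i -> k <= F i) -> (exists2 i, P i & F i = k) ->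
  \big[minn/n]_(i | P i) F i = k.
Proof.
move=> le_kn lbF [i Pi Fi]; apply/eqP; rewrite eqn_leq -{1}Fi bigmin_le //=.
by elim/big_rec: _ => // j m Pj le_km; rewrite leq_min lbF.
Qed.

Lemma card_ord_lt n k : k <= n -> #|[set v : 'I_n | v < k]| = k.
Proof.
move=> le_kn.
have inj_w : injective (widen_ord le_kn) by move=> i j /(congr1 val)/= /val_inj.
rewrite -[RHS]card_ord -(card_imset predT inj_w).
apply: eq_card => v; rewrite inE; apply/idP/imsetP => [lt_vk | [i _ ->]] /=.
  by exists (Ordinal lt_vk) => //; apply: val_inj.
exact: ltn_ord.
Qed.

(** The form in which both lower bounds arise: a labelling [f] of the vertices
    by branches, with any label above [k] for a vertex in no branch. *)
Lemma card_ge_of_hit_all_but_one (T : finType) (S : {set T}) (f : T -> nat) k :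
  (forall i j, i < j <= k -> exists2 v, v \in S & (f v == i) || (f v == j)) ->
  k <= #|S|.
Proof.
move=> hit; pose s := [seq f v | v <- enum S].
have <- : size s = #|S| by rewrite size_map -cardE.
have miss_le1 : count (fun i => i \notin s) (iota 0 k.+1) <= 1.
  rewrite -size_filter; set m := filter _ _.
  have: sorted ltn m.
    by apply: sorted_filter (iota_ltn_sorted _ _); apply: ltn_trans.
  have: forall i, i \in m -> (i <= k) && (i \notin s).
    by move=> i; rewrite mem_filter mem_iota => /andP[-> /=]; rewrite ltnS => ->.
  case: m => [|i [|j m]] //= Hm /andP[lt_ij _].
  have /andP[_ /mapP si] := Hm i (mem_head _ _).
  have /andP[le_jk /mapP sj] : (j <= k) && (j \notin s).
    by apply: Hm; rewrite !inE eqxx orbT.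
  have [|v Sv /orP[] /eqP fv] := hit i j; first by rewrite lt_ij.
    by case: si; exists v; rewrite ?mem_enum.
  by case: sj; exists v; rewrite ?mem_enum.
have split_iota :
    count (mem s) (iota 0 k.+1) + count (fun i => i \notin s) (iota 0 k.+1) = k.+1.
  by rewrite (count_predC (mem s)) size_iota.
have: count (mem s) (iota 0 k.+1) <= size s.
  rewrite -size_filter; apply: uniq_leq_size.
    by rewrite filter_uniq ?iota_uniq.
  by move=> i; rewrite mem_filter => /andP[].
lia.
Qed.

(** * Recognising the graph distance *)

Section GraphDistance.
Variables (G : sgraph) (d : G -> G -> nat).
Hypothesis d_eq0 : forall x y, (d x y == 0) = (x == y).
Hypothesis d_adj : forall x y z, adj y z -> d x z <= (d x y).+1.
Hypothesis d_pred :
  forall x y, 0 < d x y -> exists2 z, adj z y & d x y = (d x z).+1.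

Lemma walk_of_distance x y :
  exists p, [/\ path (@adj G) x p, last x p = y & size p = d x y].
Proof.
move: {2}(d x y) (erefl (d x y)) => k; elim: k y => [|k IHk] y dxy.
  by exists [::]; split=> //=; apply/eqP; rewrite -?d_eq0 dxy.
have [|z adj_zy] := @d_pred x y; first by rewrite dxy.
rewrite dxy => -[dxz]; have [p [xp pz sp]] := IHk z (esym dxz).
exists (rcons p y); rewrite rcons_path last_rcons size_rcons xp pz sp dxz.
by split.
Qed.

Lemma path_ge_distance x y p :
  path (@adj G) x p -> last x p = y -> d x y <= size p.
Proof.
elim/last_ind: p y => [|p z IHp] y; rewrite ?rcons_path ?last_rcons /=.
  by move=> _ <-; rewrite leqn0 d_eq0.
case/andP=> xp adj_z <-; rewrite size_rcons.
by apply: leq_trans (d_adj _ adj_z) _; rewrite ltnS IHp.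
Qed.

Lemma connected_of_distance : connected G.
Proof.
move=> x y; have [p [xp py _]] := walk_of_distance x y.
by apply/connectP; exists p.
Qed.

(** Descending along [d_pred] gives a walk of length [d x y], hence a path that
    is no longer; no path is shorter, since [d x] grows by at most 1 per edge. *)
Lemma dist_of_distance x y : dist x y = d x y.
Proof.
apply/eqP; rewrite eqn_leq; apply/andP; split; last first.
  have [p /and3P[xp /eqP py _] <-] := dist_attained (connected_of_distance x y).
  exact: path_ge_distance.
have [p [xp py <-]] := walk_of_distance x y.
case/shortenP: xp py => q xq uq sub_qp qy.
have le_q : size q <= size p by case/andP: uq => _ /uniq_leq_size; apply.
by apply: leq_trans (dist_le _) le_q; rewrite /graph_path xq qy eqxx uq.
Qed.

End GraphDistance.

(** * The windmill with a tail *)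

(** The numbers below [t] are the spokes, [t] is the hub and larger numbers form
    the tail.  The graph is defined from this function: two vertices are adjacent
    when its value is 1. *)
Definition windmill_dist (r t u v : nat) : nat :=
  if u == v then 0
  else if u < t then
    if v < t then (if (u + r == v) || (v + r == u) then 1 else 2)
    else (v - t).+1
  else if v < t then (u - t).+1
  else (u - v) + (v - u).

(* Conditions free of conditionals are split first: those are the ones that
   linear arithmetic can use as hypotheses. *)
Ltac dist_cases :=
  rewrite /windmill_dist /=;
  repeat match goal with
  | |- context [if ?b then _ else _] =>
    lazymatch b with
    | context [if _ then _ else _] => fail
    | _ => case: (boolP b) => ? /=
    end
  end; try lia.

Section Windmill.
Variables r t n : nat.

Local Notation d := (windmill_dist r t).

Lemma d_sym u v : d u v = d v u.
Proof. by dist_cases. Qed.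

Lemma d_eq0 u v : (d u v == 0) = (u == v).
Proof. by dist_cases. Qed.

Definition windmill_adj : rel 'I_n := fun u v => d u v == 1.

Lemma windmill_adj_sym : symmetric windmill_adj.
Proof. by move=> u v; rewrite /windmill_adj d_sym. Qed.

Lemma windmill_adj_irrefl : irreflexive windmill_adj.
Proof. by move=> u; rewrite /windmill_adj /windmill_dist eqxx. Qed.

Definition windmill : sgraph := SGraph windmill_adj_sym windmill_adj_irrefl.
Local Notation W := windmill.

Hypotheses (r_ge2 : 2 <= r) (le_rt : r <= t) (le_t2r : t <= 2 * r).
Hypothesis lt_tn : t.+1 < n.

Lemma d_step u v w : d v w = 1 -> d u w <= (d u v).+1.
Proof. by dist_cases. Qed.

Lemma d_spoke_outer u v : u < t -> t <= v -> d u v = (v - t).+1.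
Proof. by dist_cases. Qed.

Lemma d_spokes u v : u < t -> v < t -> u != v ->
  d u v = (if (u + r == v) || (v + r == u) then 1 else 2).
Proof. by move=> lt_ut lt_vt /negPf ne; rewrite /windmill_dist ne lt_ut lt_vt. Qed.

Lemma d_twins v i : i + r < t -> v != i -> v != i + r -> d v i = d v (i + r).
Proof.
move=> lt_irt ne1 ne2; have [lt_vt|le_tv] := ltnP v t; last first.
  by rewrite d_sym [RHS]d_sym !d_spoke_outer //; lia.
by rewrite !d_spokes //; dist_cases.
Qed.

Lemma d_leaf v i : i < r -> t <= i + r -> v != i ->
  d v i = if v < t then 2 else (v - t).+1.
Proof.
move=> lt_ir le_tir ne; have [lt_vt|le_tv] := ltnP v t; last first.
  by rewrite d_sym d_spoke_outer //; lia.
by rewrite d_spokes //; dist_cases.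
Qed.

Lemma d_tail_start v : v < t -> d v t.+1 = 2.
Proof. by move=> lt_vt; rewrite d_spoke_outer //; lia. Qed.

(** For a neighbour [y] of the hub, the edge from the hub to [y] is then as far
    from [v] as the hub itself. *)
Lemma hub_nearer v y : (if y < t then v != y else (y == t.+1) && (v <= t)) ->
  d t v <= d y v.
Proof. by dist_cases. Qed.

Lemma windmill_d_eq0 (x y : W) : (d x y == 0) = (x == y).
Proof. exact: d_eq0. Qed.

Lemma windmill_d_adj (x y z : W) : adj y z -> d x z <= (d x y).+1.
Proof. by move/eqP; apply: d_step. Qed.

Lemma windmill_d_pred (x y : W) :
  0 < d x y -> exists2 z, adj z y & d x y = (d x z).+1.
Proof.
move=> d_gt0; have [dxy1|dxy_ne1] := eqVneq (d x y) 1.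
  by exists x; rewrite /= /windmill_adj dxy1 // /windmill_dist eqxx.
(* Nonadjacent vertices are joined through the hub or along the tail. *)
pose z := if y < t then t else if y < x then y.+1 else y.-1.
have lt_zn : z < n by have := ltn_ord x; have := ltn_ord y; rewrite /z; dist_cases.
exists (Ordinal lt_zn); rewrite /= /windmill_adj /= /z;
  by move: d_gt0 dxy_ne1; dist_cases.
Qed.

Lemma windmill_connected : connected W.
Proof. exact: connected_of_distance windmill_d_eq0 windmill_d_pred. Qed.

Lemma windmill_dist_eq (x y : W) : dist x y = d x y.
Proof.
exact: (dist_of_distance windmill_d_eq0 windmill_d_adj windmill_d_pred).
Qed.

(** * Metric dimension *)

(** The branches are labelled by [0, ..., r]: the spokes [i] and [i + r] have
    label [i], the tail has label [r], and the hub lies in no branch.  For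
    labels [i < j], the vertex [i] and a suitable [y] of label [i] or [j] are
    told apart only from branches [i] and [j]. *)
Lemma windmill_dim_ge (S : {set W}) : metric_generator S -> r <= #|S|.
Proof.
move=> genS.
pose f (v : W) := if v < r then v : nat else if v < t then v - r
  else if v == t :> nat then r.+1 else r.
apply: (@card_ge_of_hit_all_but_one W S f) => i j /andP[lt_ij le_jr].
(* The twin of i if there is one; otherwise i is a leaf, and so is spoke j. *)
pose y := if i + r < t then i + r else if j < r then j else t.+1.
have lt_in : i < n by lia.
have lt_yn : y < n by rewrite /y; dist_cases.
have neq_iy : Ordinal lt_in != Ordinal lt_yn :> W.
  by rewrite -val_eqE /= /y; dist_cases.
have /forallP/(_ (Ordinal lt_in))/forallP/(_ (Ordinal lt_yn)) := genS.
rewrite neq_iy => /existsP[v /andP[Sv]].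
rewrite /distinguishes !windmill_dist_eq /= => dv.
exists v => //; apply: contraNT dv; rewrite negb_or /f /y => /andP[fi fj].
have lt_ir : i < r by lia.
have ne_vi : v != i :> nat by apply: contraNneq fi => ->; rewrite lt_ir.
have [lt_irt|le_tir] := ltnP (i + r) t.
  apply/eqP; apply: d_twins => //; apply: contraNneq fi => ->.
  by clear fj; dist_cases.
rewrite d_leaf //; case: (ltnP j r) => [lt_jr|le_rj].
  have ne_vj : v != j :> nat by apply: contraNneq fj => ->; rewrite lt_jr.
  by rewrite d_leaf //; lia.
have le_vt : v <= t by move: fj; dist_cases.
case: (ltnP v t) => [lt_vt|le_tv]; first by rewrite d_tail_start.
by have -> : v = t :> nat by [lia]; dist_cases.
Qed.

Lemma core_spokes_resolve x y : (forall v, v < r -> d v x = d v y) -> x = y.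
Proof.
move=> same.
have [lt_xr|le_rx] := ltnP x r.
  by apply/eqP; rewrite -d_eq0 -same // d_eq0.
have [lt_yr|le_ry] := ltnP y r.
  by apply/esym/eqP; rewrite -d_eq0 same // d_eq0.
(* The boolean z == r, read as 0 or 1, is a spoke below r other than z - r. *)
have far z : r <= z -> z < t -> d (z - r) z = 1 /\ d (z == r) z = 2.
  by move=> le_rz lt_zt; rewrite !d_spokes //; dist_cases.
have outer v z : v < r -> t <= z -> d v z = (z - t).+1.
  by move=> lt_vr; apply: d_spoke_outer; lia.
have [lt_xt|le_tx] := ltnP x t; have [lt_yt|le_ty] := ltnP y t.
- have [near1 _] := far x le_rx lt_xt.
  by have := same (x - r) ltac:(lia); rewrite near1 d_spokes //; dist_cases.
- by have [] := far x le_rx lt_xt; rewrite !same ?outer //; lia.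
- by have [] := far y le_ry lt_yt; rewrite -!same ?outer //; lia.
- by have := same 0 ltac:(lia); rewrite !outer //; lia.
Qed.

Lemma windmill_dim : dim W = r.
Proof.
have le_rn : r <= n by lia.
apply: bigmin_eq; first by rewrite card_ord.
  exact: windmill_dim_ge.
exists [set v : W | v < r]; last exact: card_ord_lt.
apply/forallP=> x; apply/forallP=> y; apply/implyP.
apply: contraNT => /existsPn same.
have {}same v : v < r -> d v x = d v y.
  move=> lt_vr; have lt_vn : v < n by lia.
  have := same (Ordinal lt_vn); rewrite inE /= lt_vr /= /distinguishes negbK.
  by rewrite !windmill_dist_eq => /eqP.
exact/eqP/val_inj/core_spokes_resolve.
Qed.

(** * Edge metric dimension *)

Lemma windmill_edgeP (e : {set W}) : e \in edges W ->
  exists u w : W, [/\ e = [set u; w], u < w & d u w = 1].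
Proof.
rewrite inE => /existsP[u /existsP[w /andP[/eqP duw /eqP ->]]].
have [lt_uw|lt_wu|eq_uw] := ltngtP u w.
- by exists u, w.
- by exists w, u; rewrite d_sym setUC.
- by move: duw; rewrite eq_uw /windmill_dist eqxx.
Qed.

(** Here the branches are the spokes [0, ..., t-1] and the tail, labelled [t]. *)
Lemma windmill_edim_ge (S : {set W}) : edge_metric_generator S -> t <= #|S|.
Proof.
move=> genS.
pose f (v : W) :=
  if v < t then v : nat else if v == t :> nat then t.+1 else t.
have lt_n : t < n by lia.
pose hub : W := Ordinal lt_n.
apply: (@card_ge_of_hit_all_but_one W S f) => i j /andP[lt_ij le_jt].
(* The neighbour of the hub on branch j. *)
pose y := if j < t then j else t.+1.
have lt_in : i < n by lia.
have lt_yn : y < n by rewrite /y; dist_cases.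
pose e1 := [set hub; Ordinal lt_in : W]; pose e2 := [set hub; Ordinal lt_yn : W].
have E1 : e1 \in edges W.
  rewrite inE; apply/existsP; exists hub; apply/existsP; exists (Ordinal lt_in).
  by rewrite eqxx andbT /= /windmill_adj /=; dist_cases.
have E2 : e2 \in edges W.
  rewrite inE; apply/existsP; exists hub; apply/existsP; exists (Ordinal lt_yn).
  by rewrite eqxx andbT /= /windmill_adj /= /y; dist_cases.
have neq12 : e1 != e2.
  apply/eqP=> /setP/(_ (Ordinal lt_in)).
  by rewrite !inE -!val_eqE /= /y; dist_cases.
have /forall_inP/(_ e1 E1)/forall_inP/(_ e2 E2) := genS.
rewrite neq12 => /existsP[v /andP[Sv]].
rewrite /edge_distinguishes !edge_dist2 !windmill_dist_eq /= => dv.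
exists v => //; apply: contraNT dv; rewrite negb_or /f /y => /andP[fi fj].
have near_i : d t v <= d i v.
  by apply: hub_nearer; move: fi; clear fj; dist_cases.
have near_y : d t v <= d y v.
  by apply: hub_nearer; move: fj; clear fi; rewrite /y; dist_cases.
by rewrite (minn_idPl near_i) (minn_idPl near_y).
Qed.

Lemma edge_shape u w : u < w -> d u w = 1 ->
  [\/ u < t /\ w = t, w = u + r /\ w < t | t <= u /\ w = u.+1].
Proof.
move=> lt_uw; have [lt_wt|le_tw] := ltnP w t.
  by move=> duw; constructor 2; move: duw; dist_cases.
have [lt_ut|le_tu] := ltnP u t; move=> duw; [constructor 1|constructor 3];
by move: duw; dist_cases.
Qed.

Lemma spokes_resolve_edges u1 w1 u2 w2 :
  u1 < w1 -> d u1 w1 = 1 -> u2 < w2 -> d u2 w2 = 1 ->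
  (forall v, v < t -> minn (d u1 v) (d w1 v) = minn (d u2 v) (d w2 v)) ->
  u1 = u2 /\ w1 = w2.
Proof.
move=> lt1 d1 lt2 d2 same.
have min_eq0 a b : (minn a b == 0) = (a == 0) || (b == 0).
  by rewrite -leqn0 geq_min !leqn0.
(* A spoke lies on an edge exactly when its distance to it is 0. *)
have same_mem v : v < t -> ((u1 == v) || (w1 == v)) = ((u2 == v) || (w2 == v)).
  by move/same => eqm; rewrite -!(d_eq0 _ v) -!min_eq0 eqm.
have := same 0 ltac:(lia).
case: (edge_shape lt1 d1) => -[A1 B1]; case: (edge_shape lt2 d2) => -[A2 B2].
all: have := same_mem u1; have := same_mem w1.
all: have := same_mem u2; have := same_mem w2.
(* Only for two edges without spokes is the distance to spoke 0 needed. *)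
1-8: by clear same same_mem d1 d2; move=> ? ? ? ? _; lia.
by move=> _ _ _ _; subst; dist_cases.
Qed.

Lemma windmill_edim : edim W = t.
Proof.
have le_tn : t <= n by lia.
apply: bigmin_eq; first by rewrite card_ord.
  exact: windmill_edim_ge.
exists [set v : W | v < t]; last exact: card_ord_lt.
apply/forall_inP=> e1 /windmill_edgeP[u1 [w1 [-> lt1 d1]]].
apply/forall_inP=> e2 /windmill_edgeP[u2 [w2 [-> lt2 d2]]].
apply/implyP; apply: contraNT => /existsPn same.
have {}same v : v < t -> minn (d u1 v) (d w1 v) = minn (d u2 v) (d w2 v).
  move=> lt_vt; have lt_vn : v < n by lia.
  have := same (Ordinal lt_vn).
  rewrite inE /= lt_vt /= /edge_distinguishes negbK.
  by rewrite !edge_dist2 !windmill_dist_eq => /eqP.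
suff [eq_u eq_w] : u1 = u2 :> nat /\ w1 = w2 :> nat.
  by rewrite (val_inj eq_u) (val_inj eq_w).
exact: spokes_resolve_edges.
Qed.

End Windmill.

Theorem theorem9 (r t n : nat) :
  2 <= r -> r <= t -> t <= 2 * r -> 2 * r <= n - 2 ->
  exists G : sgraph, [/\ connected G, #|G| = n, dim G = r & edim G = t].
Proof.
move=> r_ge2 le_rt le_t2r le_2rn; have lt_tn : t.+1 < n by lia.
exists (windmill r t n); split.
- exact: windmill_connected.
- exact: card_ord.
- exact: windmill_dim.
- exact: windmill_edim.
Qed.
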